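(* Let $a\in\mathbb{N}$ and $b,m,n\in\mathbb{N}_0$ be such that $m\leq n$. Then $A(b,a;n,m)\in\mathbb{Z}[q]$ if and only if $A(b,a;n+la,\,m+ka)\in\mathbb{Z}[q]$ for all integers $k,l$ such that $0\leq m+ka\leq n+la$.
   Context: $\mathbb{N}$ is the set of positive integers and $\mathbb{N}_0=\mathbb{N}\cup\{0\}$. $\mathbb{Z}[q]$ is the ring of polynomials in the indeterminate $q$ with integer coefficients. Let $(q;q)_0=1$ and $(q;q)_n=\prod_{i=1}^{n}(1-q^i)$. For $m,n\in\mathbb{N}_0$ the $q$-binomial coefficient is $\left[{n\atop m}\right]=\frac{(q;q)_n}{(q;q)_m(q;q)_{n-m}}$ if $n\geq m\geq 0$, and $0$ otherwise. For $a\in\mathbb{N}$ and $b,m,n\in\mathbb{N}_0$ define the rational function of $q$ $$A(b,a;n,m)=\frac{1-q^b}{1-q^a}\left[{n\atop m}\right].$$ The statement $A(b,a;n,m)\in\mathbb{Z}[q]$ means that this rational function is a polynomial in $q$ with integer coefficients. *)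

(* Defs.v *)
From HB Require Import structures.
From mathcomp Require Import all_boot all_order all_algebra.

Set Implicit Arguments.
Unset Strict Implicit.
Unset Printing Implicit Defensive.

Import GRing.Theory Num.Theory.
Local Open Scope ring_scope.

(* Rational functions of q are elements of the fraction field of Z[q], the
   polynomial indeterminate 'X playing the role of q. *)
Definition ratfun := {fraction {poly int}}.

Definition tofrac_poly (p : {poly int}) : ratfun := @tofrac {poly int} p.

Definition q : ratfun := tofrac_poly 'X.

Definition qpoch (n : nat) : ratfun := \prod_(1 <= i < n.+1) (1 - q ^+ i).

Definition qbinom (n m : nat) : ratfun :=
  if (m <= n)%N then qpoch n / (qpoch m * qpoch (n - m)) else 0.

(* Division in a field is total with x / 0 = 0, so this matches the usual
   rational function only for 0 < a. *)
Definition A (b a n m : nat) : ratfun :=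
  (1 - q ^+ b) / (1 - q ^+ a) * qbinom n m.

Definition in_Zq (f : ratfun) : Prop :=
  exists p : {poly int}, f = tofrac_poly p.

(* Main.v *)
Require Import Defs.
From mathcomp Require Import all_boot all_order all_algebra.
From mathcomp Require Import cyclotomic algC ring.

(** Put [P = (1 - 'X^b) * [n choose m]_'X], a polynomial over the integers.
    Asking that [A b a n m] be a polynomial is asking that [1 - 'X^a] divide
    [P]; since [1 - 'X^a] is monic up to sign and has [a] distinct complex
    roots, this holds exactly when every [a]-th root of unity [z] is a root of
    [P], that is, satisfies [z ^+ b = 1] or kills the q-binomial coefficient
    (lemma [in_Zq_AP]).

    If [z] is a primitive [d]-th root of unity, the q-Lucas theorem
    (lemma [gauss_lucas]) factors the value at [z] as an ordinary binomial
    coefficient, nonzero for [m <= n], times the q-binomial coefficient of the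
    residues of [n] and [m] modulo [d].  Hence it vanishes exactly when
    [n %% d < m %% d] (lemma [gauss_prim_eq0]).  As [d] divides [a], this
    condition does not change when multiples of [a] are added to [n] and [m],
    so neither does the criterion. *)

Set Implicit Arguments.
Unset Strict Implicit.
Unset Printing Implicit Defensive.

Import Order.TTheory GRing.Theory Num.Theory.
Local Open Scope ring_scope.

(** The q-binomial coefficient is taken at an arbitrary element of a ring, by
    the q-Pascal rule, so that a single object specializes to a polynomial, to
    a rational function and to a value at a root of unity. *)
Fixpoint gauss (R : nzRingType) (x : R) (n m : nat) : R :=
  match n, m with
  | _, 0%N => 1
  | 0%N, _.+1 => 0
  | n'.+1, m'.+1 => gauss x n' m' + x ^+ m'.+1 * gauss x n' m'.+1
  end.

Definition poch (R : nzRingType) (x : R) (n : nat) : R :=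
  \prod_(1 <= i < n.+1) (1 - x ^+ i).

Lemma gauss0 (R : nzRingType) (x : R) n : gauss x n 0 = 1.
Proof. by case: n. Qed.

Lemma gaussS (R : nzRingType) (x : R) n m :
  gauss x n.+1 m.+1 = gauss x n m + x ^+ m.+1 * gauss x n m.+1.
Proof. by []. Qed.

Lemma gauss_small (R : nzRingType) (x : R) n m :
  (n < m)%N -> gauss x n m = 0.
Proof.
elim: n m => [|n IHn] [|m] //= lt_nm.
by rewrite !IHn ?mulr0 ?addr0 // ltnW.
Qed.

Lemma gaussnn (R : nzRingType) (x : R) n : gauss x n n = 1.
Proof. by elim: n => //= n ->; rewrite gauss_small // mulr0 addr0. Qed.

Lemma rmorph_gauss (R S : nzRingType) (f : {rmorphism R -> S}) x n m :
  f (gauss x n m) = gauss (f x) n m.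
Proof.
elim: n m => [|n IHn] [|m] /=; rewrite ?rmorph0 ?rmorph1 //.
by rewrite rmorphD rmorphM rmorphXn !IHn.
Qed.

Lemma poch0 (R : nzRingType) (x : R) : poch x 0 = 1.
Proof. by rewrite /poch big_nil. Qed.

Lemma pochS (R : nzRingType) (x : R) n :
  poch x n.+1 = poch x n * (1 - x ^+ n.+1).
Proof. by rewrite /poch big_nat_recr. Qed.

Lemma poch_neq0 (R : idomainType) (x : R) n :
  (forall i, (0 < i <= n)%N -> x ^+ i != 1) -> poch x n != 0.
Proof.
elim: n => [|n IHn] x_n1; first by rewrite poch0 oner_eq0.
rewrite pochS mulf_neq0 ?IHn //; last by rewrite subr_eq0 eq_sym x_n1 //=.
by move=> i /andP[i_gt0 le_in]; rewrite x_n1 // i_gt0 leqW.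
Qed.

(** The q-Pascal rule is compatible with the product formula because
    [(1 - x ^+ i) + x ^+ i * (1 - x ^+ j) = 1 - x ^+ (i + j)]. *)
Lemma gauss_poch (R : comNzRingType) (x : R) m k :
  gauss x (m + k) m * (poch x m * poch x k) = poch x (m + k).
Proof.
elim: m k => [|m IHm] k; first by rewrite gauss0 poch0 !mul1r.
elim: k => [|k IHk]; first by rewrite addn0 gaussnn poch0 mul1r mulr1.
have {}IHm := IHm k.+1; rewrite pochS !addnS in IHm *.
rewrite pochS addSnnS addnS in IHk; rewrite addSn gaussS [poch x m.+1]pochS.
have x_mk : x ^+ (m + k).+2 = x ^+ m.+1 * x ^+ k.+1.
  by rewrite -exprD addSn addnS.
rewrite [in RHS]pochS x_mk {x_mk}.
move: (x ^+ m.+1) (x ^+ k.+1) IHm IHk => u v IHm IHk.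
transitivity ((1 - u) * poch x (m + k).+1 + u * (1 - v) * poch x (m + k).+1).
  by rewrite -{1}IHm -IHk; ring.
by ring.
Qed.

Section RootsOfUnity.

Variables (R : idomainType) (d : nat) (z : R).
Hypothesis z_prim : d.-primitive_root z.

Let d_gt0 : (0 < d)%N := prim_order_gt0 z_prim.

Lemma prim_poch_neq0 n : (n < d)%N -> poch z n != 0.
Proof.
move=> lt_nd; apply: poch_neq0 => i /andP[i_gt0 le_in].
by rewrite -(prim_order_dvd z_prim) gtnNdvd // (leq_ltn_trans le_in).
Qed.

Lemma gauss_small_neq0 n m : (m <= n < d)%N -> gauss z n m != 0.
Proof.
move=> /andP[le_mn /prim_poch_neq0]; apply: contraNneq => g0.
by rewrite -(subnKC le_mn) -gauss_poch subnKC // g0 mul0r.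
Qed.

(** In the product formula for the row [d], the numerator vanishes at [z] while
    the denominator does not. *)
Lemma gauss_row_eq0 m : (0 < m < d)%N -> gauss z d m = 0.
Proof.
move=> /andP[m_gt0 lt_md].
have poch_d : poch z d = 0.
  by rewrite -(prednK d_gt0) pochS prednK // prim_expr_order // subrr mulr0.
have /eqP := gauss_poch z m (d - m).
rewrite subnKC 1?ltnW // poch_d !mulf_eq0 !(negPf (prim_poch_neq0 _)) //.
  by rewrite !orbF => /eqP.
by rewrite ltn_subrL m_gt0.
Qed.

(** The q-Lucas theorem.  Along the q-Pascal rule, the residues modulo [d] of
    [n] and [m] follow the q-Pascal rule themselves until they wrap around;
    a wrap of [n] alone produces an inner entry of the row [d], which vanishes,
    and a simultaneous wrap is the Pascal rule for the quotients. *)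
Lemma gauss_lucas n m :
  gauss z n m = 'C(n %/ d, m %/ d)%:R * gauss z (n %% d) (m %% d).
Proof.
have wrap k : (d %| k.+1)%N -> (k %% d)%N = d.-1.
  move=> d_k; have := modnS k d; rewrite d_k => mod_k0.
  apply: succn_inj; rewrite prednK //; apply/eqP.
  rewrite eqn_leq ltn_pmod //= dvdn_leq //.
  by move: d_k; rewrite /dvdn -addn1 -modnDml addn1.
have step k : ~~ (d %| k.+1)%N -> ((k %% d).+1 < d)%N.
  move=> nd_k; have := ltn_pmod k.+1 d_gt0.
  by rewrite modnS (negPf nd_k).
elim: n m => [|n IHn] m.
  case: m => [|m]; first by rewrite !div0n !mod0n bin0 gauss0 mulr1.
  rewrite div0n mod0n gauss_small //.
  have [lt_md|le_dm] := ltnP m.+1 d.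
    by rewrite (divn_small lt_md) (modn_small lt_md) gauss_small ?mulr0.
  by rewrite bin_small ?mul0r // divn_gt0.
case: m => [|m]; first by rewrite div0n mod0n bin0 !gauss0 mulr1.
rewrite gaussS !IHn -(prim_expr_mod z_prim m.+1) !modnS !divnS //.
case: ifPn => d_m; case: ifPn => d_n; rewrite ?add1n ?add0n.
- rewrite (wrap _ d_m) (wrap _ d_n) gaussnn !gauss0 expr0 mul1r !mulr1.
  by rewrite binS natrD addrC.
- rewrite (wrap _ d_m) !gauss0 gauss_small; last first.
    by have := step _ d_n; rewrite -{2}(prednK d_gt0).
  by rewrite expr0 mul1r mulr0 add0r.
- rewrite (wrap _ d_n) mulrCA -mulrDr -gaussS prednK // gauss_row_eq0 //.
    by rewrite gauss_small ?mulr0.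
  by rewrite step.
- by rewrite mulrCA -mulrDr -gaussS.
Qed.

End RootsOfUnity.

Lemma gauss_prim_eq0 (R : numDomainType) (d : nat) (z : R) n m :
  d.-primitive_root z -> (m <= n)%N ->
  (gauss z n m == 0) = (n %% d < m %% d)%N.
Proof.
move=> z_prim le_mn; rewrite (gauss_lucas z_prim) mulf_eq0 pnatr_eq0.
rewrite -leqn0 leqNgt bin_gt0 leq_div2r //=.
have [lt_nm|le_nm] := ltnP; first by rewrite gauss_small ?eqxx.
apply: negbTE; apply: (gauss_small_neq0 z_prim).
by rewrite le_nm ltn_pmod ?(prim_order_gt0 z_prim).
Qed.

(** Euclidean division by the monic polynomial ['X^a - 1] leaves a remainder
    with fewer than [a + 1] coefficients, which vanishes if it has the [a]
    powers of a primitive root as roots. *)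
Lemma dvd_Xn_sub_1P (a : nat) (p : {poly int}) : (0 < a)%N ->
  (exists r, p = r * (1 - 'X^a)) <->
  (forall z : algC, z ^+ a = 1 -> (map_poly intr p).[z] = 0).
Proof.
move=> a_gt0; split=> [[r ->] z za|p_roots].
  rewrite rmorphM /= rmorphB /= map_polyXn rmorph1.
  by rewrite hornerM !hornerE za subrr mulr0.
have mon_a : ('X^a - 1 : {poly int}) \is monic by rewrite monic_Xn_sub_1.
have size_a : size ('X^a - 1 : {poly int}) = a.+1 by rewrite size_Xn_sub_1.
have def_p := Pdiv.RingMonic.rdivp_eq mon_a p.
set r := Pdiv.Ring.rmodp _ _ in def_p.
exists (- Pdiv.Ring.rdivp p ('X^a - 1)).
suff r0 : r = 0 by rewrite {1}def_p r0 addr0 mulNr -mulrN opprB.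
have le_ra : (size r <= a)%N.
  by rewrite -ltnS -size_a Pdiv.Ring.ltn_rmodpN0 // monic_neq0.
have r_roots (z : algC) : z ^+ a = 1 -> root (map_poly intr r) z.
  move=> za; rewrite /root -(p_roots z za) def_p rmorphD rmorphM /=.
  rewrite rmorphB /= map_polyXn rmorph1 !hornerE za.
  by rewrite subrr mulr0 add0r.
have [w w_prim] := C_prim_root_exists a_gt0.
apply: (@map_inj_poly _ _ (intr : int -> algC)) => //.
  exact: intr_inj.
rewrite rmorph0.
apply: (@roots_geq_poly_eq0 _ _ [seq w ^+ i | i <- iota 0 a]).
- apply/allP=> _ /mapP[i _ ->].
  by rewrite r_roots // exprAC (prim_expr_order w_prim) expr1n.
- rewrite map_inj_in_uniq ?iota_uniq // => i j; rewrite !mem_iota /= add0n.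
  move=> lt_ia lt_ja /eqP; rewrite (eq_prim_root_expr w_prim).
  by rewrite !modn_small // => /eqP.
- by rewrite size_map size_iota (leq_trans (size_poly _ _)).
Qed.

Lemma tofrac_polyM (p r : {poly int}) :
  tofrac_poly (p * r) = tofrac_poly p * tofrac_poly r.
Proof. exact: rmorphM. Qed.

Lemma tofrac_poly_q (b : nat) : tofrac_poly (1 - 'X^b) = 1 - q ^+ b.
Proof. by rewrite /tofrac_poly rmorphB rmorph1 rmorphXn. Qed.

Lemma one_sub_q_neq0 (i : nat) : (0 < i)%N -> 1 - q ^+ i != 0.
Proof.
move=> i_gt0; rewrite -tofrac_poly_q /tofrac_poly tofrac_eq0.
by rewrite -opprB oppr_eq0 monic_neq0 ?monic_Xn_sub_1.
Qed.

Lemma qbinomE (n m : nat) : (m <= n)%N ->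
  qbinom n m = tofrac_poly (gauss 'X n m).
Proof.
move=> le_mn; rewrite /qbinom le_mn /tofrac_poly rmorph_gauss -/q.
have poch_q k : poch q k != 0.
  apply: poch_neq0 => i /andP[i_gt0 _].
  by rewrite eq_sym -subr_eq0 one_sub_q_neq0.
have := gauss_poch q m (n - m); rewrite subnKC // -[qpoch n]/(poch q n) => <-.
by rewrite mulfK // mulf_neq0.
Qed.

Lemma in_Zq_AP (a b m n : nat) : (0 < a)%N -> (m <= n)%N ->
  in_Zq (A b a n m) <->
  (forall z : algC, z ^+ a = 1 -> (z ^+ b == 1) || (gauss z n m == 0)).
Proof.
move=> a_gt0 le_mn; set p : {poly int} := (1 - 'X^b) * gauss 'X n m.
have defA : A b a n m = tofrac_poly p / tofrac_poly (1 - 'X^a).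
  by rewrite /A qbinomE // /p tofrac_polyM !tofrac_poly_q mulrAC.
have den_neq0 : tofrac_poly (1 - 'X^a) != 0.
  by rewrite tofrac_poly_q one_sub_q_neq0.
have horner_p (z : algC) :
    (map_poly intr p).[z] = (1 - z ^+ b) * gauss z n m.
  rewrite rmorphM /= rmorphB /= map_polyXn rmorph1 hornerM !hornerE.
  congr (_ * _); rewrite rmorph_gauss /= map_polyX.
  by rewrite -/(horner_eval z _) rmorph_gauss /= /horner_eval hornerX.
have -> : in_Zq (A b a n m) <-> exists r, p = r * (1 - 'X^a).
  rewrite defA; split=> [][r].
    move/(canRL (divfK den_neq0)); rewrite -tofrac_polyM => /eqP.
    by rewrite tofrac_eq => /eqP; exists r.
  by move=> ->; exists r; rewrite tofrac_polyM mulfK.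
rewrite dvd_Xn_sub_1P //; split=> p_roots z /p_roots.
  by rewrite horner_p => /eqP; rewrite mulf_eq0 subr_eq0 eq_sym.
by rewrite horner_p => z_root; apply/eqP; rewrite mulf_eq0 subr_eq0 eq_sym.
Qed.

Lemma modn_shift (a d n : nat) (k : int) : (d %| a)%N ->
  (0 <= n%:Z + k * a%:Z) -> (`|(n%:Z + k * a%:Z)%R|%N %% d)%N = (n %% d)%N.
Proof.
move=> /dvdnP[c ->] ge0; apply/eqP; rewrite -eqz_nat -!modz_nat gez0_abs //.
by rewrite PoszM mulrA addrC modzMDl.
Qed.

Theorem theorem1 (a b m n : nat) (ha : (0 < a)%N) (hmn : (m <= n)%N) :
  in_Zq (A b a n m) <->
  (forall k l : int,
     (0 <= m%:Z + k * a%:Z)%R ->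
     (m%:Z + k * a%:Z <= n%:Z + l * a%:Z)%R ->
     in_Zq (A b a `|(n%:Z + l * a%:Z)%R|%N `|(m%:Z + k * a%:Z)%R|%N)).
Proof.
split=> [A_poly k l ge0 le_kl|/(_ 0 0)]; last first.
  by rewrite !mul0r !addr0 !absz_nat lez_nat; apply.
have le_abs : (`|(m%:Z + k * a%:Z)%R| <= `|(n%:Z + l * a%:Z)%R|)%N.
  by rewrite -lez_nat !gez0_abs // (le_trans ge0).
apply/in_Zq_AP => // z za.
have [d z_prim d_a] := prim_order_exists ha za.
rewrite (gauss_prim_eq0 z_prim) // !modn_shift ?(le_trans ge0) //.
by rewrite -(gauss_prim_eq0 z_prim hmn); move/in_Zq_AP: A_poly; apply.
Qed.
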